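(* For all integers $k\ge 2$ and $m\ge 1$, $$g_k(m,2)\le f_{4+2(k-1)}\bigl(f_4(6m-2)\bigr),$$ where $g_k(m,2)$ is the minimal natural number $n$ such that for every coloring $c:\mathrm{FIN}_k(n)\to\{0,1\}$ there exists a block sequence of length $m$ of elements of $\mathrm{FIN}_k(n)$ such that $c$ is constant on the combinatorial space it generates, and $(f_i)_{i\ge 1}$ is the Ackermann hierarchy.
   Context: Ackermann hierarchy: the functions $f_i:\mathbb{N}\to\mathbb{N}$, $i\ge 1$, are defined by $f_1(x)=2x$ and $f_{i+1}(x)=f_i^{(x)}(1)$, where $f_i^{(x)}$ denotes the $x$-fold iterate of $f_i$. $\mathbb{N}$ starts at $0$. For $k\ge 1$, $\mathrm{FIN}_k$ is the set of all functions $h:\mathbb{N}\to\{0,1,\ldots,k\}$ that attain the maximum value $k$ and whose support $\mathrm{supp}(h)=\{n\in\mathbb{N}: h(n)\neq 0\}$ is finite. For $n\in\mathbb{N}$, $\mathrm{FIN}_k(n)=\{h\in\mathrm{FIN}_k:\max(\mathrm{supp}(h))<n\}$. For $g,h\in\mathrm{FIN}_k$ write $g<h$ if $\max(\mathrm{supp}(g))<\min(\mathrm{supp}(h))$. A block sequence of length $m$ is a sequence $(h_i)_{i<m}$ of elements of $\mathrm{FIN}_k$ with $h_i<h_j$ for all $i<j<m$. The tetris operation $T$ is defined pointwise by $(Th)(x)=\max\{0,h(x)-1\}$, and $T^l$ is its $l$-th iterate; sums of functions are pointwise. The combinatorial space generated by a block sequence $(h_i)_{i<m}$ is the set of all functions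 of the form $T^{l_0}(h_{i_0})+\cdots+T^{l_{p-1}}(h_{i_{p-1}})$ with $p\ge 1$, $i_0<\cdots<i_{p-1}<m$, $l_0,\ldots,l_{p-1}\in\mathbb{N}$ and $\min\{l_0,\ldots,l_{p-1}\}=0$. The number $g_k(m,2)$ exists for all $k\ge 1$ and $m$ (finite $\mathrm{FIN}_k$ theorem). *)

(* Defs.v *)
From mathcomp Require Import all_boot.
From mathcomp Require Import boolp classical_sets functions cardinality.

Set Implicit Arguments.
Unset Strict Implicit.
Unset Printing Implicit Defensive.

Local Open Scope classical_set_scope.

(* The hierarchy is indexed from 1; the value at index 0 is a dummy. *)
Fixpoint ack (i : nat) (x : nat) : nat :=
  if i is j.+1 then
    if j is 0 then 2 * x else iter x (ack j) 1
  else 0.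

Definition is_max (A : set nat) (a : nat) : Prop :=
  A a /\ forall b, A b -> b <= a.

Definition is_min (A : set nat) (a : nat) : Prop :=
  A a /\ forall b, A b -> a <= b.

Definition supp (h : nat -> nat) : set nat := [set x | h x != 0].

(* Functions into {0, ..., k} are maps to nat bounded by k, so that pointwise
   sums need no truncation. *)
Definition FIN (k : nat) : set (nat -> nat) :=
  [set h | [/\ forall x, h x <= k, exists x, h x = k & finite_set (supp h)]].

(* For k >= 1 supports are finite and nonempty, so the extrema below exist. *)
Definition FINn (k n : nat) : set (nat -> nat) :=
  [set h | FIN k h /\ exists2 a, is_max (supp h) a & a < n].

Definition block_lt (g h : nat -> nat) : Prop :=
  exists a b, [/\ is_max (supp g) a, is_min (supp h) b & a < b].

Definition block_seq (m : nat) (hs : 'I_m -> nat -> nat) : Prop :=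
  forall i j : 'I_m, i < j -> block_lt (hs i) (hs j).

(* Truncated subtraction: max(0, h x - 1). *)
Definition tetris (h : nat -> nat) : nat -> nat := fun x => h x - 1.

Definition comb_space (m : nat) (hs : 'I_m -> nat -> nat) : set (nat -> nat) :=
  [set h | exists (p : nat) (i : 'I_p -> 'I_m) (l : 'I_p -> nat),
     [/\ 1 <= p,
         forall a b : 'I_p, a < b -> i a < i b,
         is_min (range l) 0
       & h = (fun x => \sum_(j < p) iter (l j) tetris (hs (i j)) x)]].

(* A coloring is defined on FIN_k(n) only, i.e. on the associated subtype.
   When each [hs i] is in [FINn k n], [comb_space hs] is a subset of
   [FINn k n], so ranging over [h : FINn k n] covers the whole space. *)
Definition FIN_ramsey (k m r n : nat) : Prop :=
  forall c : FINn k n -> 'I_r,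
  exists hs : 'I_m -> nat -> nat,
    [/\ forall i, FINn k n (hs i),
        block_seq hs
      & exists b : 'I_r,
          forall h : FINn k n, comb_space hs (val h) -> c h = b].

(* [is_g k m r n] says that n is the number g_k(m, r). *)
Definition is_g (k m r n : nat) : Prop := is_min (FIN_ramsey k m r) n.

(* Main.v *)
Require Import Defs.
From mathcomp Require Import all_boot.
From mathcomp Require Import zify.
From mathcomp Require Import boolp classical_sets functions cardinality.

Set Implicit Arguments.
Unset Strict Implicit.
Unset Printing Implicit Defensive.

(** Write an element of FIN_k(n) as a vector of exponents: the value [a] becomes
    the exponent [k - a], so that the tetris operation adds 1 to every entry, a
    coloring only sees exponents up to [k], and belonging to FIN_k means having
    an entry 0.

    Induction on [k]. Given a coloring of FIN_(k+1), repeated use of the FIN_k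
    theorem, applied to the once-shifted combinations of a segment and to the
    coloring by all contexts on the left and on the right, gives [M] blocks such
    that a word [u a v], with [a] a shifted combination of an interval of blocks
    and [u], [v] arbitrary, has a color independent of [a]. Taking the new blocks
    [T x + y + T z], with [x < y < z] consecutive blocks, every gap between
    unshifted blocks is such an interval, so that the color of a combination
    depends only on which blocks are unshifted, and the FIN_1 theorem applies.

    For FIN_1, the same interval argument with "a single point" in place of "a
    shifted combination", and the pigeonhole principle in place of FIN_k, gives
    blocks such that the color depends only on the number of blocks used; then
    Folkman's theorem on sums of natural numbers, obtained from iterated Hilbert
    cubes, finishes the proof. *)

(** * Substitution of exponent vectors *)

(* [Es] lists the blocks h_j of a block sequence, which together cover all
   positions; [subst e Es] is the sum of the T^(e_j) h_j, a block being absent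
   when its exponent is at least [k]. *)
Definition subst (e : seq nat) (Es : seq (seq nat)) : seq nat :=
  flatten [seq map (addn p.1) p.2 | p <- zip e Es].

(** Two modes, so that the interval argument is proved once: [false] is membership in FIN_k, [true]
    is the one-point version from which FIN_1 starts. *)
Definition zeros (sg : bool) (e : seq nat) : bool :=
  if sg then count_mem 0 e == 1 else 0 \in e.

Definition blocks (sg : bool) (m n : nat) (Es : seq (seq nat)) : Prop :=
  [/\ size Es = m, size (flatten Es) = n & all (zeros sg) Es].

(** With [K = k], all exponents from [K] on stand for the value 0. Capped contexts are finite in
    number, so a coloring by contexts again has finitely many colors. *)
Definition capped (K n : nat) (C : Type) (c : seq nat -> C) : Prop :=
  forall e, size e = n -> c (map (minn K) e) = c e.

Lemma zerosW sg e : zeros sg e -> 0 \in e.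
Proof.
by case: sg => //=; rewrite -has_pred1 has_count => /eqP ->.
Qed.

Lemma subst_cons a e E Es :
  subst (a :: e) (E :: Es) = map (addn a) E ++ subst e Es.
Proof. by []. Qed.

Lemma subst_cat e1 e2 Es1 Es2 : size e1 = size Es1 ->
  subst (e1 ++ e2) (Es1 ++ Es2) = subst e1 Es1 ++ subst e2 Es2.
Proof. by move=> se; rewrite /subst zip_cat // map_cat flatten_cat. Qed.

Lemma size_subst e Es : size e = size Es -> size (subst e Es) = size (flatten Es).
Proof.
elim: e Es => [|a e IH] [|E Es] //= [se].
by rewrite subst_cons !size_cat size_map IH.
Qed.

Lemma subst_shift d e Es : subst (map (addn d) e) Es = map (addn d) (subst e Es).
Proof.
elim: e Es => [|a e IH] [|E Es] //=; rewrite !subst_cons map_cat IH -map_comp.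
by congr (_ ++ _); apply: eq_map => x /=; rewrite addnA.
Qed.

Lemma subst_id e : subst e (nseq (size e) [:: 0]) = e.
Proof. by elim: e => //= a e IH; rewrite subst_cons IH /= addn0. Qed.

Lemma mem0_addn a (E : seq nat) : (0 \in map (addn a) E) = (a == 0) && (0 \in E).
Proof.
by elim: E => [|x E IH]; rewrite ?andbF //= !inE IH eq_sym addn_eq0 (eq_sym 0 x) andb_orr.
Qed.

Lemma count0_addn a (E : seq nat) :
  count_mem 0 (map (addn a) E) = (a == 0) * count_mem 0 E.
Proof.
by elim: E => [|x E IH] /=; rewrite ?muln0 // IH addn_eq0; case: (a == 0); case: eqP.
Qed.

Lemma mem0_subst sg e Es : all (zeros sg) Es -> size e = size Es ->
  (0 \in subst e Es) = (0 \in e).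
Proof.
elim: e Es => [|a e IH] [|E Es] //= /andP[/zerosW E0 aEs] [se].
by rewrite subst_cons mem_cat mem0_addn E0 andbT IH // inE eq_sym.
Qed.

Lemma count0_subst e Es : all (zeros true) Es -> size e = size Es ->
  count_mem 0 (subst e Es) = count_mem 0 e.
Proof.
elim: e Es => [|a e IH] [|E Es] //= /andP[/eqP E0 aEs] [se].
by rewrite subst_cons count_cat count0_addn E0 muln1 IH // /= eq_sym.
Qed.

Lemma zeros_subst sg e Es : all (zeros sg) Es -> size e = size Es ->
  zeros sg (subst e Es) = zeros sg e.
Proof.
case: sg => aEs se; last by rewrite /zeros (mem0_subst aEs).
by rewrite /zeros count0_subst.
Qed.

(** Composition of block sequences: [reshape] hands to each block of [Es] the consecutive blocks of
    [Fs] that replace its entries. *)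
Definition subst_comp (Es Fs : seq (seq nat)) : seq (seq nat) :=
  [seq subst p.1 p.2 | p <- zip Es (reshape (shape Es) Fs)].

Lemma subst_comp_cons E Es Fs :
  subst_comp (E :: Es) Fs =
  subst E (take (size E) Fs) :: subst_comp Es (drop (size E) Fs).
Proof. by []. Qed.

Lemma subst_subst e Es Fs : size e = size Es -> size (flatten Es) = size Fs ->
  subst (subst e Es) Fs = subst e (subst_comp Es Fs).
Proof.
elim: e Es Fs => [|a e IH] [|E Es] Fs //=; first by case: Fs.
move=> [se]; rewrite size_cat => sF.
rewrite subst_comp_cons !subst_cons -subst_shift -{1}(cat_take_drop (size E) Fs).
rewrite subst_cat ?IH //; first by rewrite size_drop; lia.
by rewrite size_map size_take; case: ifP; lia.
Qed.

Lemma blocks_comp sg m n l Es Fs : blocks sg m n Es -> blocks sg n l Fs ->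
  blocks sg m l (subst_comp Es Fs).
Proof.
move=> [<- sE aE] [sF sl aF]; move: sF; rewrite -{}sl -{}sE {m n l}; move: aE aF.
elim: Es Fs => [|E Es IH] Fs /=; first by case: Fs.
move=> /andP[ZE aEs] aF; rewrite size_cat subst_comp_cons => sF.
have sEt : size E = size (take (size E) Fs).
  by rewrite size_take; case: ifP; lia.
move: aF; rewrite -{1}(cat_take_drop (size E) Fs) all_cat => /andP[aF1 aF2].
have sd : size (drop (size E) Fs) = size (flatten Es) by rewrite size_drop; lia.
have [s1 s2 s3] := IH _ aEs aF2 sd.
split=> /=; first by rewrite s1.
- by rewrite size_cat s2 size_subst // -{3}(cat_take_drop (size E) Fs) flatten_cat size_cat.
- by rewrite zeros_subst // ZE.
Qed.

Lemma blocks_cat sg m n m' n' Es Es' : blocks sg m n Es -> blocks sg m' n' Es' ->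
  blocks sg (m + m') (n + n') (Es ++ Es').
Proof.
by case=> <- <- a1 [<- <- a2]; split; rewrite ?flatten_cat ?size_cat // all_cat a1.
Qed.

Lemma blocks_id sg n : blocks sg n n (nseq n [:: 0]).
Proof.
split; rewrite ?size_nseq //; first by elim: n => //= n ->.
by rewrite all_nseq; case: sg; rewrite orbT.
Qed.

Lemma capped_eq K n (C : Type) (c : seq nat -> C) e e' :
  capped K n c -> size e = n -> size e' = n ->
  map (minn K) e = map (minn K) e' -> c e = c e'.
Proof. by move=> cc se se' ee; rewrite -cc // ee cc. Qed.

Lemma capped_subst sg K m n (C : Type) (c : seq nat -> C) Es :
  capped K n c -> blocks sg m n Es -> capped K m (fun e => c (subst e Es)).
Proof.
move=> cc [sE sF _] e se; apply: (capped_eq cc);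
  rewrite ?size_subst ?size_map ?se //.
elim: e Es {se sE sF} => [|a e IH] [|E Es] //=.
rewrite !subst_cons !map_cat IH -!map_comp; congr (_ ++ _).
by apply: eq_map => x /=; lia.
Qed.

(* [sg] selects combinations with exactly one unshifted block, and [d] is the
   number of tetris operations applied to every combination. *)
Definition homogenizing (sg : bool) (d K m r n : nat) : Prop :=
  forall (C : finType) (c : seq nat -> C), #|C| <= r -> capped K n c ->
  exists Es, blocks sg m n Es /\
    forall e e' : seq nat, size e = m -> size e' = m -> zeros sg e -> zeros sg e' ->
      c (map (addn d) (subst e Es)) = c (map (addn d) (subst e' Es)).

(** * Homogeneous intervals *)

Section Intervals.
Variables (sg : bool) (d K r : nat) (G : nat -> nat -> nat).
Hypothesis stepG : forall m s, 0 < m -> homogenizing sg d K m s (G m s).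

(** [q] counts the positions outside the segment; they have [K.+1 ^ q] capped contents, whence the
    number of colors. One block obtained from [G] is kept, the others are the positions of the next
    round. *)
Fixpoint inner_bound (s q : nat) : nat :=
  if s is s'.+1 then G (inner_bound s' q.+1).+1 (r ^ (K.+1 ^ q)) else 0.

(** [t] blocks remain to be made, and [b] final ones already stand on the right. *)
Fixpoint outer_bound (t b : nat) : nat :=
  if t is t'.+1 then inner_bound (outer_bound t' b.+1).+1 b else 0.

(** A vector is colored by the function sending each capped context to the color of the whole word;
    homogeneity then holds in all contexts at once. *)
Lemma step_context p b m n (C : finType) (c : seq nat -> C) :
  #|C| <= r -> capped K (p + n + b) c -> 0 < m -> n = G m (r ^ (K.+1 ^ (p + b))) ->
  exists Es, blocks sg m n Es /\
    forall u v e e' : seq nat, size u = p -> size v = b -> size e = m -> size e' = m ->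
      zeros sg e -> zeros sg e' ->
      c (u ++ map (addn d) (subst e Es) ++ v) = c (u ++ map (addn d) (subst e' Es) ++ v).
Proof.
move=> cC cc m0 nE.
pose D := {ffun p.-tuple 'I_K.+1 * b.-tuple 'I_K.+1 -> C}.
pose c' (e : seq nat) : D :=
  [ffun t : p.-tuple 'I_K.+1 * b.-tuple 'I_K.+1 => c (map val t.1 ++ e ++ map val t.2)].
have cD : #|D| <= r ^ (K.+1 ^ (p + b)).
  rewrite card_ffun card_prod !card_tuple card_ord expnD.
  by rewrite leq_exp2r // muln_gt0 !expn_gt0.
have capc' : capped K n c'.
  move=> e se; apply/ffunP=> t; rewrite !ffunE; apply: (capped_eq cc).
  - by rewrite !size_cat !size_map !size_tuple se addnA.
  - by rewrite !size_cat !size_map !size_tuple se addnA.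
  rewrite !map_cat -!map_comp; congr (_ ++ (_ ++ _)).
  by apply: eq_map => x /=; lia.
have stp := @stepG m (r ^ (K.+1 ^ (p + b))) m0; rewrite -nE in stp.
have [Es [bE hE]] := stp D c' cD capc'.
exists Es; split=> // u v e e' su sv se se' ze ze'.
have [sE1 sE2 _] := bE.
pose tu : p.-tuple 'I_K.+1 := [tuple inord (minn K (nth 0 u i)) | i < p].
pose tv : b.-tuple 'I_K.+1 := [tuple inord (minn K (nth 0 v i)) | i < b].
have tE q (w : seq nat) : size w = q ->
    map val [tuple inord (minn K (nth 0 w i)) : 'I_K.+1 | i < q] = map (minn K) w.
  move=> sw; apply: (@eq_from_nth _ 0); first by rewrite size_map size_tuple size_map.
  move=> i; rewrite size_map size_tuple => iq.
  rewrite (nth_map ord0) ?size_tuple // (nth_map 0) ?sw //.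
  have -> : i = Ordinal iq by [].
  by rewrite -tnth_nth tnth_mktuple /= inordK ?ltnS ?geq_minl.
have key (a : seq nat) : size a = m ->
   c (u ++ map (addn d) (subst a Es) ++ v) = c' (map (addn d) (subst a Es)) (tu, tv).
  move=> sa; rewrite ffunE /= !tE //; apply: (capped_eq cc);
    rewrite ?size_cat ?size_map ?size_subst ?sE2 ?su ?sv ?addnA //; try lia.
  rewrite !map_cat -!map_comp; congr (_ ++ (_ ++ _)); apply: eq_map => x /=; lia.
by rewrite !key // (hE e e').
Qed.

(** The intervals here reach the right end of the segment. [step_context] settles those starting at
    the first block; for the others this block joins the left context, and the remaining blocks are
    merged by induction. *)
Lemma inner_step s p b (C : finType) (c : seq nat -> C) :
  #|C| <= r -> capped K (p + inner_bound s (p + b) + b) c ->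
  exists Es, blocks sg s (inner_bound s (p + b)) Es /\
    forall u w v e e' : seq nat, size u = p -> size v = b -> size w + size e = s ->
      size e' = size e -> zeros sg e -> zeros sg e' ->
      c (u ++ subst (w ++ map (addn d) e) Es ++ v) =
      c (u ++ subst (w ++ map (addn d) e') Es ++ v).
Proof.
elim: s p c => [|s IH] p c cC cc.
  exists [::]; split=> // u w v e e' _ _ sw se.
  have /size0nil -> : size e = 0 by lia.
  by rewrite /zeros; case: sg.
set L' := inner_bound s (p.+1 + b).
have [] := step_context (m := L'.+1) cC cc isT; first by [].
move=> Es1 [bE1 hE1].
pose I1 := nseq p [:: 0] ++ Es1 ++ nseq b [:: 0].
have bI1 : blocks sg (p + (L'.+1 + b)) (p + (inner_bound s.+1 (p + b) + b)) I1.
  apply: blocks_cat; first exact: blocks_id.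
  by apply: blocks_cat => //; apply: blocks_id.
have cc1 : capped K (p.+1 + L' + b) (fun e => c (subst e I1)).
  have -> : p.+1 + L' + b = p + (L'.+1 + b) by lia.
  by apply: capped_subst bI1; rewrite addnA.
have [Es2 [bE2 hE2]] := IH p.+1 _ cC cc1.
have bE2' : blocks sg s.+1 L'.+1 ([:: 0] :: Es2).
  exact: (blocks_cat (blocks_id sg 1) bE2).
exists (subst_comp ([:: 0] :: Es2) Es1); split; first exact: blocks_comp bE1.
have [s11 s12 _] := bE1.
have [s21 s22 a2] := bE2'.
move=> u w v e e' su sv sw se ze ze'.
case: w sw => [|x w] sw.
  rewrite add0n in sw; rewrite !cat0s -!subst_subst ?size_map ?s22 ?s11 ?s21 //; try by rewrite ?se.
  by rewrite !subst_shift; apply: hE1; rewrite ?size_subst ?zeros_subst ?s22 ?s21 ?se.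
have split1 (a : seq nat) : size a = size e ->
  c (u ++ subst ((x :: w) ++ map (addn d) a) (subst_comp ([:: 0] :: Es2) Es1) ++ v) =
  c (subst (rcons u x ++ subst (w ++ map (addn d) a) Es2 ++ v) I1).
  move=> sa; rewrite -subst_subst ?s11 ?s22 ?s21 //; last by rewrite size_cat size_map sa.
  rewrite cat_cons subst_cons /= addn0 cat_rcons.
  rewrite subst_cat ?size_nseq // -cat_cons subst_cat.
    by rewrite -su -sv !subst_id.
  have [sE2 sfE2 _] := bE2.
  by rewrite s11 -cat1s size_cat size_subst ?sfE2 // sE2 size_cat size_map sa; case: sw.
rewrite !split1 //; apply: hE2; rewrite ?size_rcons ?su //.
by move: sw => /=; lia.
Qed.

(* The last [b] blocks are final: the assumption is the conclusion for the
   intervals that end inside them, and it survives any change of the others. *)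
Lemma outer_step t b (C : finType) (c : seq nat -> C) :
  #|C| <= r -> capped K (outer_bound t b + b) c ->
  (forall u v e e' : seq nat, size u + size e + size v = outer_bound t b + b ->
     size v < b -> size e' = size e -> zeros sg e -> zeros sg e' ->
     c (u ++ map (addn d) e ++ v) = c (u ++ map (addn d) e' ++ v)) ->
  exists Es, blocks sg (t + b) (outer_bound t b + b) Es /\
    forall u v e e' : seq nat, size u + size e + size v = t + b ->
      size e' = size e -> zeros sg e -> zeros sg e' ->
      c (subst (u ++ map (addn d) e ++ v) Es) =
      c (subst (u ++ map (addn d) e' ++ v) Es).
Proof.
elim: t b c => [|t IH] b c cC cc hc.
  exists (nseq b [:: 0]); split; first exact: blocks_id.
  move=> u v e e' sz se ze ze'.
  have sz' : size u + size e + size v = b by [].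
  have E a : size a = size e ->
      subst (u ++ map (addn d) a ++ v) (nseq b [:: 0]) = u ++ map (addn d) a ++ v.
    by move=> sa; rewrite -[RHS]subst_id !size_cat size_map sa addnA sz'.
  rewrite !E //; apply: hc => //.
  have : 0 < size e by case: (e) ze => //; rewrite /zeros; case: sg.
  lia.
(* The last block of [Es1] becomes final; the others are still to be merged. *)
have [Es1 [bE1 hE1]] := @inner_step (outer_bound t b.+1).+1 0 b C c cC cc.
pose I1 := Es1 ++ nseq b [:: 0].
set n' := outer_bound t b.+1 in Es1 bE1 hE1 I1.
have bI1 : blocks sg (n'.+1 + b) (outer_bound t.+1 b + b) I1.
  by apply: blocks_cat bE1 (blocks_id _ _).
have [s11 s12 a1] := bE1.
have E1 : n'.+1 + b = n' + b.+1 by rewrite addnS.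
have cc1 : capped K (n' + b.+1) (fun e => c (subst e I1)).
  by rewrite -E1; apply: capped_subst bI1.
case: (IH b.+1 _ cC cc1) => [|Es2 [bE2 hE2]].
  move=> u v e e' sz sv se ze ze'.
  (* An interval ending at the new final block reaches the end of the segment, where [hE1] applies;
     one ending further right falls under [hc] after substitution. *)
  have [vb|vb] := ltnP (size v) b; last first.
    have {sv vb} vb : size v = b by lia.
    have X a : size a = size e -> subst (u ++ map (addn d) a ++ v) I1 =
        [::] ++ subst (u ++ map (addn d) a) Es1 ++ v.
      move=> sa; rewrite catA subst_cat; last first.
        by rewrite size_cat size_map s11 sa; rewrite -/n' in sz; lia.
      by rewrite -vb subst_id.
    rewrite !X //; apply: hE1 => //; rewrite -/n' in sz; lia.
  pose J := Es1 ++ nseq (b - size v) [:: 0].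
  have IJ : I1 = J ++ nseq (size v) [:: 0].
    by rewrite /J -catA -nseqD subnK // ltnW.
  have sJ : size J = size u + size e.
    by rewrite size_cat s11 size_nseq; rewrite -/n' in sz; lia.
  have aJ : all (zeros sg) J.
    by rewrite all_cat a1; have [_ _ ->] := blocks_id sg (b - size v).
  have sfJ : size (flatten J) + size v = outer_bound t.+1 b + b.
    have [_ <- _] := bI1; rewrite IJ flatten_cat size_cat.
    by have [_ -> _] := blocks_id sg (size v).
  have aJ2 : all (zeros sg) (drop (size u) J).
    by move: aJ; rewrite -{1}(cat_take_drop (size u) J) all_cat => /andP[].
  have X a : size a = size e -> subst (u ++ map (addn d) a ++ v) I1 =
      subst u (take (size u) J) ++ map (addn d) (subst a (drop (size u) J)) ++ v.
    move=> sa; have sua : size (u ++ map (addn d) a) = size J.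
      by rewrite sJ size_cat size_map sa.
    rewrite catA IJ subst_cat //.
    rewrite subst_id -{1}(cat_take_drop (size u) J) subst_cat ?subst_shift ?catA //.
    by rewrite size_take sJ; case: ifP; lia.
  have sJ1 : size u = size (take (size u) J).
    by rewrite size_take sJ; case: ifP; lia.
  have sJ2 : size (drop (size u) J) = size e.
    by rewrite size_drop sJ; lia.
  rewrite !X //; apply: hc => //; rewrite ?zeros_subst ?size_subst ?se //.
  by rewrite -sfJ -{3}(cat_take_drop (size u) J) flatten_cat size_cat.
exists (subst_comp Es2 I1); split.
  have -> : t.+1 + b = t + b.+1 by rewrite addnS.
  by apply: blocks_comp bE2 _; rewrite -/n' -E1.
have [s21 s22 _] := bE2; have [sI _ _] := bI1.
move=> u v e e' sz se ze ze'.
rewrite -!subst_subst; try (by rewrite s22 sI -/n' -E1);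
  try (by rewrite s21 !size_cat !size_map; lia).
by apply: hE2 => //; lia.
Qed.

Lemma interval_homogeneous t (C : finType) (c : seq nat -> C) :
  #|C| <= r -> capped K (outer_bound t 0) c ->
  exists Es, blocks sg t (outer_bound t 0) Es /\
    forall u v e e' : seq nat, size u + size e + size v = t ->
      size e' = size e -> zeros sg e -> zeros sg e' ->
      c (subst (u ++ map (addn d) e ++ v) Es) =
      c (subst (u ++ map (addn d) e' ++ v) Es).
Proof.
move=> cC; rewrite -[outer_bound t 0]addn0 -{2 4}[t]addn0 => cc.
by case: (outer_step cC cc) => // Es H; exists Es.
Qed.

End Intervals.

Definition gowers : nat -> nat -> nat -> nat -> Prop := homogenizing false 0.

Lemma map_add0n e : map (addn 0) e = e.
Proof. exact: map_id. Qed.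

Lemma blocksW sg m n Es : blocks sg m n Es -> blocks false m n Es.
Proof. by case=> s1 s2 /allP a; split=> //; apply/allP => E /a /zerosW. Qed.

(** Capping a shifted vector at [k.+1] is shifting the vector capped at [k], so a coloring of
    shifted vectors is a coloring for FIN_k. *)
Lemma homogenizing_shift k m r n : gowers k m r n -> homogenizing false 1 k.+1 m r n.
Proof.
move=> R C c cC cc.
have cc' : capped k n (fun e => c (map (addn 1) e)).
  move=> e se; apply: (capped_eq cc); rewrite ?size_map //.
  by rewrite -!map_comp; apply: eq_map => x /=; lia.
have [Es [bE hE]] := R C _ cC cc'.
exists Es; split=> // e e' se se' ze ze'.
by have := hE e e' se se' ze ze'; rewrite !map_add0n.
Qed.

(** * From FIN_k to FIN_(k+1) *)

(** Next to a letter 0 the flanks carry 1, so each gap between unshifted blocks is a positive word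
    containing 1, that is, a shifted word containing 0. *)
Definition sandwich (e : seq nat) : seq nat :=
  flatten [seq [:: y.+1; y; y.+1] | y <- e].

Lemma sandwich_cons y e : sandwich (y :: e) = [:: y.+1, y, y.+1 & sandwich e].
Proof. by []. Qed.

Lemma sandwichE e : sandwich e = subst e (nseq (size e) [:: 1; 0; 1]).
Proof.
by elim: e => // y e IH; rewrite sandwich_cons IH /= subst_cons /= addn0 addn1.
Qed.

Lemma sandwich_cat e1 e2 : sandwich (e1 ++ e2) = sandwich e1 ++ sandwich e2.
Proof. by rewrite /sandwich map_cat flatten_cat. Qed.

Lemma size_sandwich e : size (sandwich e) = 3 * size e.
Proof. by elim: e => // y e IH; rewrite sandwich_cons /= IH; lia. Qed.

Lemma blocks_sandwich N : blocks false N (3 * N) (nseq N [:: 1; 0; 1]).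
Proof.
split; rewrite ?size_nseq //; last by rewrite all_nseq orbT.
by elim: N => //= N ->; lia.
Qed.

Lemma sandwich_pos e : 0 \notin e -> 0 \notin sandwich e.
Proof.
by elim: e => // y e IH; rewrite sandwich_cons !inE !negb_or => /andP[y0 /IH ->]; rewrite y0.
Qed.

Lemma succ_pred_map e : 0 \notin e -> map (addn 1) (map predn e) = e.
Proof.
by elim: e => //= y e IH; rewrite inE negb_or => /andP[y0 /IH ->]; case: y y0.
Qed.

Lemma split_last_zero (e : seq nat) : 0 \in e ->
  exists e1 e2, e = e1 ++ 0 :: e2 /\ 0 \notin e2.
Proof.
elim: e => //= x e IH; rewrite inE; have [/IH[e1 [e2 [-> n0]]] _|n0] := boolP (0 \in e).
  by exists (x :: e1), e2.
by rewrite orbF => /eqP <-; exists [::], e.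
Qed.

Lemma split_first_zero (e : seq nat) : 0 \in e ->
  exists e1 e2, e = e1 ++ 0 :: e2 /\ 0 \notin e1.
Proof.
move=> e0; exists (take (index 0 e) e), (drop (index 0 e).+1 e); split.
  by rewrite -[LHS](cat_take_drop (index 0 e)) (drop_nth 0) ?index_mem // nth_index.
by rewrite in_take_leq ?index_size // ltnn.
Qed.

Section Absorption.
Variables (C : Type) (N : nat) (c : seq nat -> C).
Hypothesis ch : forall u v e e' : seq nat, size u + size e + size v = 3 * N ->
  size e' = size e -> 0 \in e -> 0 \in e' ->
  c (u ++ map (addn 1) e ++ v) = c (u ++ map (addn 1) e' ++ v).

Lemma interval_eq (u v a a' : seq nat) : size u + size a + size v = 3 * N ->
  size a' = size a -> 0 \notin a -> 0 \notin a' -> 1 \in a -> 1 \in a' ->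
  c (u ++ a ++ v) = c (u ++ a' ++ v).
Proof.
move=> sz sa a0 a0' a1 a1'; rewrite -(succ_pred_map a0) -(succ_pred_map a0').
apply: ch; rewrite ?size_map ?sa //; first exact: (map_f predn a1).
exact: (map_f predn a1').
Qed.

(* The changed letter is joined to the nearest unshifted block by letters that
   are all positive, so both words lie in one interval of shifted blocks. *)
Lemma sandwich_change1 (e1 e2 : seq nat) (y y' : nat) :
  (size e1 + size e2).+1 = N -> 0 \in e1 ++ e2 -> 0 < y -> 0 < y' ->
  c (sandwich (e1 ++ y :: e2)) = c (sandwich (e1 ++ y' :: e2)).
Proof.
move=> sN; rewrite mem_cat => /orP[] e0 y0 y0'.
  have [f1 [f2 [ef f0]]] := split_last_zero e0.
  have E z : sandwich (e1 ++ z :: e2) = (sandwich f1 ++ [:: 1; 0]) ++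
      (1 :: sandwich f2 ++ [:: z.+1; z; z.+1]) ++ sandwich e2.
    rewrite ef -catA sandwich_cat cat_cons sandwich_cons sandwich_cat sandwich_cons.
    by rewrite -!catA /= -catA.
  have Z z : 0 < z -> 0 \notin 1 :: sandwich f2 ++ [:: z.+1; z; z.+1].
    by case: z => // z _; rewrite inE mem_cat (negbTE (sandwich_pos f0)).
  rewrite !E; apply: interval_eq; rewrite ?Z ?mem_head //; last by rewrite /= !size_cat.
  rewrite /= !size_cat /= !size_sandwich.
  have : size e1 = size f1 + (size f2).+1 by rewrite ef size_cat.
  lia.
have [f1 [f2 [ef f0]]] := split_first_zero e0.
have E z : sandwich (e1 ++ z :: e2) = sandwich e1 ++
    (z.+1 :: z :: z.+1 :: sandwich f1 ++ [:: 1]) ++ [:: 0, 1 & sandwich f2].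
  by rewrite ef sandwich_cat sandwich_cons sandwich_cat sandwich_cons !cat_cons -catA.
have Z z : 0 < z -> 0 \notin z.+1 :: z :: z.+1 :: sandwich f1 ++ [:: 1].
  by case: z => // z _; rewrite !inE mem_cat (negbTE (sandwich_pos f0)).
have O z : 1 \in z.+1 :: z :: z.+1 :: sandwich f1 ++ [:: 1].
  by rewrite !inE mem_cat mem_head !orbT.
rewrite !E; apply: interval_eq; rewrite ?Z ?O //.
rewrite /= !size_cat /= !size_sandwich.
have : size e2 = size f1 + (size f2).+1 by rewrite ef size_cat.
lia.
Qed.

(** Letters are changed from left to right. Only positive ones change, so the unshifted block
    required by [sandwich_change1] survives. *)
Lemma sandwich_pattern_cat (u e e' : seq nat) : size (u ++ e) = N ->
  0 \in u ++ e -> map (eq_op^~ 0) e = map (eq_op^~ 0) e' ->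
  c (sandwich (u ++ e)) = c (sandwich (u ++ e')).
Proof.
elim: e e' u => [|x e IH] [|x' e'] //= u se e0 [xx ee].
case: x x' xx se e0 => [|x] [|x'] //= _ se e0.
  by rewrite -!cat_rcons; apply: IH; rewrite ?cat_rcons.
have e1 : 0 \in u ++ e by move: e0; rewrite !mem_cat !inE.
rewrite (@sandwich_change1 _ _ _ x'.+1) //; last by rewrite -se size_cat /= addnS.
rewrite -!cat_rcons; apply: IH; rewrite // cat_rcons.
  by rewrite -se !size_cat.
by move: e1; rewrite !mem_cat inE.
Qed.

Lemma sandwich_pattern (e e' : seq nat) : size e = N -> 0 \in e ->
  map (eq_op^~ 0) e = map (eq_op^~ 0) e' -> c (sandwich e) = c (sandwich e').
Proof. exact: (@sandwich_pattern_cat [::]). Qed.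

End Absorption.

Lemma gowers_succ k m r (G : nat -> nat -> nat) N :
  (forall m s, 0 < m -> gowers k m s (G m s)) -> gowers 1 m r N ->
  gowers k.+1 m r (outer_bound k.+1 r G (3 * N) 0).
Proof.
move=> RG R1 C c cC cc.
have stG m' s : 0 < m' -> homogenizing false 1 k.+1 m' s (G m' s).
  by move=> m0; apply/homogenizing_shift/RG.
have [Es [bE hE]] := interval_homogeneous stG cC cc.
have hp := sandwich_pattern (c := fun e => c (subst e Es)) hE.
have sand e : size e = N -> sandwich e = subst e (nseq N [:: 1; 0; 1]).
  by move=> <-; apply: sandwichE.
(* Capping at 1 keeps only the pattern of unshifted blocks, which gives a coloring for FIN_1. *)
pose c1 (e : seq nat) := c (subst (sandwich (map (minn 1) e)) Es).
have cc1 : capped 1 N c1.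
  move=> e se; rewrite /c1 -map_comp; congr (c (subst (sandwich _) _)).
  by apply: eq_map => x /=; lia.
have [Fs [bF hF]] := R1 C c1 cC cc1.
have [f1 f2 f3] := bF.
exists (subst_comp (subst_comp Fs (nseq N [:: 1; 0; 1])) Es); split.
  by apply: blocks_comp bE; apply: blocks_comp bF (blocks_sandwich N).
have key e : size e = m -> 0 \in e ->
    c (subst e (subst_comp (subst_comp Fs (nseq N [:: 1; 0; 1])) Es)) = c1 (subst e Fs).
  move=> se e0.
  have [g1 g2 g3] := blocks_comp bF (blocks_sandwich N).
  have [h1 h2 h3] := bE.
  rewrite -subst_subst ?g1 ?se ?g2 ?h1 // -subst_subst ?f1 ?f2 ?size_nseq //.
  have sF : size (subst e Fs) = N by rewrite size_subst ?f1.
  rewrite -sand // /c1; apply: hp => //; rewrite ?size_map //.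
    by rewrite (mem0_subst f3) // f1.
  by rewrite -map_comp; apply: eq_map => x /=; lia.
move=> e e' se se' ze ze'; rewrite !map_add0n !key //.
by have := hF e e' se se' ze ze'; rewrite !map_add0n.
Qed.

(** * The theorem for FIN_1 *)

Lemma pigeonhole (T : Type) (C : finType) (f : T -> C) (m : nat) (s : seq T) :
  #|C| * m < size s -> exists b, m < count (fun x => f x == b) s.
Proof.
move=> ls; apply/existsP; apply: contraLR ls; rewrite negb_exists -leqNgt => /forallP H.
have -> : size s = \sum_(b : C) count (fun x => f x == b) s.
  elim: s {H} => [|x s IH] /=; first by rewrite big1.
  rewrite big_split /= -IH (bigD1 (f x)) //= eqxx big1 // => b.
  by rewrite eq_sym => /negbTE ->.
rewrite -sum_nat_const; apply: leq_sum => b _; by rewrite leqNgt H.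
Qed.

(** Each block has its only 0 at a marked position. An unmarked position joins the following block
    with exponent 1, and everything after the last chosen mark joins the last block. *)
Lemma pick_blocks (bs : seq bool) m : 0 < m <= count id bs ->
  exists Es, blocks true m (size bs) Es /\
    forall e, size e = m -> zeros true e -> nth false bs (index 0 (subst e Es)).
Proof.
elim: bs m => [|b bs IH] m; first by case: m.
case: b => [|] /=; last first.
  move=> mb; have [Es [[s1 s2 a] hE]] := IH m mb.
  case: Es s1 s2 a hE => [sm|E Es s1 s2 a hE]; first by rewrite -sm in mb.
  exists ((1 :: E) :: Es); split.
    by split=> //=; move: s2 => /= ->.
  case=> [|x e] se ze; first by move: ze.
  by have := hE _ se ze; rewrite !subst_cons /= addn1.
case: m => // -[|m] mb.
  exists [:: 0 :: nseq (size bs) 1]; split.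
    by split; rewrite //= ?cats0 ?size_nseq // count_nseq.
  by case=> [|[|x] [|y e]].
have [Es [bE hE]] := IH m.+1 mb.
exists ([:: 0] :: Es); split; first exact: (blocks_cat (blocks_id true 1) bE).
case=> [|[|x] e] // [se] ze.
by rewrite subst_cons; apply: hE.
Qed.

Lemma minn1_pos e : 0 \notin e -> map (minn 1) e = nseq (size e) 1.
Proof.
elim: e => //= x e IH; rewrite inE negb_or => /andP[x0 /IH ->].
by congr (_ :: _); lia.
Qed.

Lemma zeros_index e e' : size e = size e' -> zeros true e -> zeros true e' ->
  index 0 e = index 0 e' -> map (minn 1) e = map (minn 1) e'.
Proof.
have notin (u : seq nat) : zeros true (0 :: u) -> 0 \notin u.
  by rewrite /zeros /= add1n eqSS => /eqP c0; rewrite -has_pred1 has_count c0.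
elim: e e' => [|[|x] e IH] [|[|y] e'] //= [se].
  by move=> /notin ze /notin ze' _; rewrite !minn1_pos // se.
move=> ze ze' [ie]; congr (_ :: _); first lia.
exact: IH.
Qed.

(** Under cap 1 a vector with one zero is a point, so [c] colors [m * r] positions, and the
    pigeonhole principle gives [m] of the same color. *)
Lemma homogenizing_single m r : 0 < m -> homogenizing true 0 1 m r (m * r).
Proof.
move=> m0 C c cC cc; set n := m * r in cc *.
pose f i := c (nseq i 1 ++ 0 :: nseq (n - i.+1) 1).
have r0 : 0 < r by apply: leq_trans cC; apply/card_gt0P; exists (c [::]).
have [|b hb] := @pigeonhole _ _ f m.-1 (iota 0 n).
  rewrite size_iota /n; case: (m) m0 => // m' _.
  by rewrite mulSn mulnC addnC -addn1 leq_add ?leq_mul2l ?cC ?orbT.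
have [|Es [bE hE]] := @pick_blocks [seq f i == b | i <- iota 0 n] m.
  by rewrite m0 count_map -(prednK m0).
rewrite size_map size_iota in bE.
exists Es; split=> //.
suff key e : size e = m -> zeros true e -> c (subst e Es) = b.
  by move=> e e' se se' ze ze'; rewrite !map_add0n !key.
move=> se ze; have [s1 s2 a] := bE; have := hE _ se ze.
have zs : zeros true (subst e Es) by rewrite zeros_subst // s1.
have iin : index 0 (subst e Es) < n.
  by rewrite -s2 -(size_subst (e := e)) ?s1 // index_mem (zerosW zs).
rewrite (nth_map 0) ?size_iota // nth_iota // => /eqP <-.
have sn : size (subst e Es) = n by rewrite size_subst ?s1.
rewrite /f add0n; set i := index _ _ in iin *.
have su : size (nseq i 1 ++ 0 :: nseq (n - i.+1) 1) = n.
  by rewrite size_cat /= !size_nseq; lia.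
apply: (capped_eq cc) => //; apply: zeros_index => //; first by rewrite su.
  by rewrite /zeros count_cat /= !count_nseq.
by rewrite index_cat mem_nseq andbF /= size_nseq addn0.
Qed.

(** * Colorings that depend only on the number of zeros *)

Section CountInvariance.
Variables (C : Type) (n : nat) (c : seq nat -> C).
Hypothesis cc : capped 1 n c.
Hypothesis swap : forall u v : seq nat, size u + size v + 2 = n ->
  c (u ++ [:: 1, 0 & v]) = c (u ++ [:: 0, 1 & v]).

Lemma swap_nseq z (u v : seq nat) : size u + size v + z.+1 = n ->
  c (u ++ 1 :: nseq z 0 ++ v) = c (u ++ nseq z 0 ++ 1 :: v).
Proof.
elim: z u => [|z IH] u //= sn.
rewrite swap; last by rewrite size_cat size_nseq; lia.
by rewrite -!(cat_rcons 0); apply: IH; rewrite size_rcons; lia.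
Qed.

(** The tail is sorted first; then a positive head, which the coloring does not distinguish from 1,
    moves past the zeros by swaps. *)
Lemma count_sorted (u e : seq nat) : size (u ++ e) = n ->
  c (u ++ e) = c (u ++ nseq (count_mem 0 e) 0 ++ nseq (size e - count_mem 0 e) 1).
Proof.
elim: e u => [|x e IH] u //= sn.
rewrite -cat_rcons IH ?cat_rcons //.
have lc : count_mem 0 e <= @size nat e := count_size _ _.
set z := count_mem 0 e in lc *; clearbody z.
have sw := size_cat u (x :: e); rewrite sn /= in sw.
case: x sn sw => [|x] sn sw; first by rewrite add1n subSS.
rewrite add0n subSn // -swap_nseq; last by rewrite size_nseq; lia.
apply: (capped_eq cc); rewrite ?size_cat /= ?size_cat ?size_nseq; try lia.
rewrite !map_cat /=; congr (_ ++ _ :: _); lia.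
Qed.

Lemma count_invariant (e e' : seq nat) : size e = n -> size e' = n ->
  count_mem 0 e = count_mem 0 e' -> c e = c e'.
Proof.
move=> se se' ce.
by rewrite (@count_sorted [::] e) // (@count_sorted [::] e') //= ce se se'.
Qed.

End CountInvariance.

(** * Subset sums and Folkman's theorem *)

Definition subsum (l : seq nat) (x : nat) : Prop :=
  exists2 b, size b = size l & x = sumn (mask b l).

Lemma subsum0 l : subsum l 0.
Proof. by exists (nseq (size l) false); rewrite ?size_nseq // mask_false. Qed.

Lemma leq_sumn_mask b l : sumn (mask b l) <= sumn l.
Proof.
elim: l b => [|x l IH] [|[|] b] //=; first by rewrite leq_add2l.
exact: leq_trans (IH b) (leq_addl _ _).
Qed.

Lemma subsum_sumn l : subsum l (sumn l).
Proof. by exists (nseq (size l) true); rewrite ?size_nseq // mask_true. Qed.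

Lemma subsum_cat l1 l2 x y : subsum l1 x -> subsum l2 y -> subsum (l1 ++ l2) (x + y).
Proof.
move=> [b sb ->] [b' sb' ->]; exists (b ++ b'); rewrite ?size_cat ?sb ?sb' //.
by rewrite mask_cat // sumn_cat.
Qed.

Lemma subsum_cons a l x : subsum (a :: l) x ->
  subsum l x \/ exists2 y, subsum l y & x = a + y.
Proof.
move=> [[|[|] b] //= [sb] ->]; last by left; exists b.
by right; exists (sumn (mask b l)) => //; exists b.
Qed.

Lemma subsum_head a l x : subsum l x -> subsum (a :: l) (a + x).
Proof. by case=> b sb ->; exists (true :: b); rewrite //= sb. Qed.

Lemma subsum_tail a l x : subsum l x -> subsum (a :: l) x.
Proof. by case=> b sb ->; exists (false :: b); rewrite //= sb. Qed.

Lemma subsum_subseq l l' x : subseq l' l -> subsum l' x -> subsum l x.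
Proof.
elim: l l' x => [|a l IH] [|a' l'] x //=; first by move=> _ [[|? ?] // _ ->]; apply: subsum0.
case: eqP => [-> ss /subsum_cons[/(IH _ _ ss)|[y /(IH _ _ ss) sy ->]]|_ ss /(IH _ _ ss)].
- exact: subsum_tail.
- exact: subsum_head.
exact: subsum_tail.
Qed.

Lemma subsum_take l j : subsum l (sumn (take j l)).
Proof.
rewrite -{1}(cat_take_drop j l) -[sumn _]addn0.
by apply: subsum_cat; [apply: subsum_sumn|apply: subsum0].
Qed.

Lemma subsum_interval l i j : subsum l (sumn (drop i (take j l))).
Proof.
rewrite -{1}(cat_take_drop j l) -[sumn _]addn0 -{1}(cat_take_drop i (take j l)).
rewrite -[sumn (drop _ _)]add0n.
by do !apply: subsum_cat; try exact: subsum0; apply: subsum_sumn.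
Qed.

Fixpoint hilbert_bound (s r : nat) : nat :=
  if s is s'.+1 then hilbert_bound s' (r ^ r.+1) + r else 1.

(* The difference added to the cube is found by pigeonhole among the prefix sums
   of the last [r] numbers; coloring [x] by the colors of all its translates by
   these sums makes the smaller cube homogeneous for all of them at once. *)
Lemma hilbert_cube s r (C : finType) (c : nat -> C) l : #|C| <= r ->
  size l = hilbert_bound s r -> all (ltn 0) l ->
  exists a l', [/\ 0 < a, size l' = s, all (ltn 0) l',
    forall x, subsum (a :: l') x -> subsum l x
    & forall x, subsum l' x -> c (a + x) = c a].
Proof.
elim: s r C c l => [|s IH] r C c l cC /=.
  case: l => [|a [|? ?]] //= _; rewrite andbT => a0; exists a, [::]; split=> //.
  by move=> x [[|? ?] //= _ ->]; rewrite addn0.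
set n := hilbert_bound s _ => sl al.
set l1 := take n l; set l2 := drop n l.
have s1 : size l1 = n by rewrite size_take sl; case: ifP; lia.
have s2 : size l2 = r by rewrite size_drop sl; lia.
have le : l = l1 ++ l2 by rewrite cat_take_drop.
move: al; rewrite le all_cat => /andP[al1 al2].
(* The [r.+1] prefix sums include the empty one, so two of them get the same color. *)
pose c' x : {ffun 'I_r.+1 -> C} := [ffun j : 'I_r.+1 => c (x + sumn (take j l2))].
have cC' : #|{: {ffun 'I_r.+1 -> C}}| <= r ^ r.+1.
  by rewrite card_ffun card_ord leq_exp2r.
have [a [l' [a0 sl' al' sub hom]]] := IH _ _ c' _ cC' s1 al1.
have [j [j' [jj cjj]]] : exists j j' : 'I_r.+1, j < j' /\ c' a j = c' a j'.
  have : ~~ injectiveb (c' a).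
    apply/negP => /injectiveP /leq_card; rewrite card_ord; lia.
  move=> /injectivePn[j [j' nj ej]].
  have [?|?|/val_inj E] := ltngtP j j'; first by exists j, j'.
    by exists j', j.
  by rewrite E eqxx in nj.
have tj : sumn (take j' l2) = sumn (take j l2) + sumn (drop j (take j' l2)).
  rewrite -sumn_cat -{1}(cat_take_drop j (take j' l2)) take_takel //; exact: ltnW.
have homj x (i : 'I_r.+1) : subsum l' x ->
    c (a + x + sumn (take i l2)) = c (a + sumn (take i l2)).
  by move=> /hom /ffunP /(_ i); rewrite !ffunE.
rewrite !ffunE in cjj.
(* The shorter prefix sum goes into the base point; the rest of the longer one is the new
   difference. *)
exists (a + sumn (take j l2)), (sumn (drop j (take j' l2)) :: l'); split.
- by rewrite addn_gt0 a0.
- by rewrite /= sl'.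
- rewrite /= al' andbT.
  have : all (ltn 0) (drop j (take j' l2)).
    apply/allP => x /mem_drop /mem_take; exact/allP.
  have : 0 < size (drop j (take j' l2)).
    rewrite size_drop size_take s2; case: ifP => _; first lia.
    by have := ltn_ord j'; lia.
  by case: (drop _ _) => //= x w _ /andP[x0 _]; rewrite addn_gt0 x0.
- move=> x /subsum_cons[/subsum_cons[|[y]]|[z /subsum_cons[|[y]]]].
  + by move=> sx; rewrite -[x]addn0; apply: subsum_cat (subsum0 _); apply/sub/subsum_tail.
  + move=> sy ->; rewrite addnC; apply: subsum_cat (subsum_interval _ _ _).
    exact/sub/subsum_tail.
  + move=> sz ->; rewrite addnAC; apply: subsum_cat (subsum_take _ _).
    exact/sub/subsum_head.
  + move=> sy -> ->; rewrite addnA -(addnA a) -tj addnAC.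
    by apply: subsum_cat (subsum_take _ _); apply/sub/subsum_head.
- move=> x /subsum_cons[sx|[y sy ->]].
    by rewrite addnAC homj.
  by rewrite addnA -(addnA a) -tj addnAC homj // -cjj.
Qed.

(** A nonempty sum has the color of its first term, which reduces Folkman's theorem to the
    pigeonhole principle on the terms. *)
Fixpoint stable (C : Type) (c : nat -> C) (l : seq nat) : Prop :=
  if l is a :: l' then (forall x, subsum l' x -> c (a + x) = c a) /\ stable c l'
  else True.

Fixpoint stable_bound (t r : nat) : nat :=
  if t is t'.+1 then hilbert_bound (stable_bound t' r) r else 0.

(** The base point of a Hilbert cube is the next term; later terms are found among the sums of the
    differences of the cube. *)
Lemma stable_exists t r (C : finType) (c : nat -> C) l : #|C| <= r ->
  size l = stable_bound t r -> all (ltn 0) l ->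
  exists l', [/\ size l' = t, all (ltn 0) l', stable c l'
    & forall x, subsum l' x -> subsum l x].
Proof.
move=> cC; elim: t l => [|t IH] l /= sl al.
  exists [::]; split=> // x [[|? ?] // _ ->]; exact: subsum0.
have [a [l1 [a0 s1 al1 sub hom]]] := hilbert_cube c cC sl al.
have [l' [s' al' st sub']] := IH l1 s1 al1.
exists (a :: l'); split; rewrite /= ?s' ?a0 //.
  by split=> // x /sub'; apply: hom.
move=> x /subsum_cons[/sub' sx|[y /sub' sy ->]]; apply: sub.
  exact: subsum_tail.
exact: subsum_head.
Qed.

Lemma stable_subseq (C : Type) (c : nat -> C) l l' :
  subseq l' l -> stable c l -> stable c l'.
Proof.
elim: l l' => [|a l IH] [|a' l'] //=; case: eqP => [->|_] ss [h st].
  by split; [move=> x /(subsum_subseq ss); apply: h | apply: IH].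
exact: (IH (a' :: l')).
Qed.

Lemma stable_const (C : eqType) (c : nat -> C) b l x : stable c l ->
  all (fun a => c a == b) l -> subsum l x -> 0 < x -> c x = b.
Proof.
elim: l x => [|a l IH] x /=; first by move=> _ _ [[|? ?] // _ ->].
move=> [h st] /andP[/eqP ca al] /subsum_cons[sx|[y sy ->]] x0; first exact: IH.
by rewrite h.
Qed.

Definition folkman_bound (m r : nat) : nat := stable_bound (r * m.-1).+1 r.

Lemma folkman m r (C : finType) (c : nat -> C) : 0 < m -> #|C| <= r ->
  exists a, [/\ size a = m, all (ltn 0) a, sumn a <= folkman_bound m r
    & exists b, forall x, subsum a x -> 0 < x -> c x = b].
Proof.
move=> m0 cC; set D := folkman_bound m r.
(* Starting from [D] ones keeps every subset sum at most [D]. *)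
have sD : size (nseq D 1) = stable_bound (r * m.-1).+1 r by rewrite size_nseq.
have [|l [sl al st sub]] := stable_exists c cC sD; first by rewrite all_nseq orbT.
have [|b hb] := @pigeonhole _ _ c m.-1 l.
  by rewrite sl ltnS leq_mul2r cC orbT.
set f := filter (fun x => c x == b) l.
have ss : subseq (take m f) l.
  by apply: subseq_trans (take_subseq _ _) (filter_subseq _ _).
exists (take m f); split.
- by rewrite size_takel // size_filter -(prednK m0).
- by apply/allP => x /mem_take; rewrite mem_filter => /andP[_]; apply/allP.
- have [b' _ ->] := sub _ (subsum_subseq ss (subsum_sumn _)).
  by apply: leq_trans (leq_sumn_mask _ _) _; rewrite sumn_nseq mul1n.
exists b => x sx; apply: stable_const sx; first exact: stable_subseq st.
by apply/allP => y /mem_take; rewrite mem_filter => /andP[].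
Qed.

Lemma count0_subst_nseq e a : size e = size a ->
  count_mem 0 (subst e [seq nseq x 0 | x <- a]) = sumn (mask (map (eq_op^~ 0) e) a).
Proof.
elim: e a => [|y e IH] [|x a] //= [se]; rewrite subst_cons count_cat count0_addn IH //.
by rewrite count_nseq /= mul1n; case: y => [|y]; rewrite /= ?mul1n ?mul0n.
Qed.

Definition gowers1_bound (m r : nat) : nat :=
  outer_bound 1 r muln (folkman_bound m r) 0.

Lemma gowers1 m r : 0 < m -> gowers 1 m r (gowers1_bound m r).
Proof.
move=> m0 C c cC cc.
have [Es [bE hE]] := interval_homogeneous (fun m s m0 => @homogenizing_single m s m0) cC cc.
set D := folkman_bound m r in bE hE.
have cc1 := capped_subst cc bE.
have inv := count_invariant cc1.
have {}inv e e' : size e = D -> size e' = D -> count_mem 0 e = count_mem 0 e' ->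
    c (subst e Es) = c (subst e' Es).
  apply: inv => u v sz.
  by have := hE u v [:: 1; 0] [:: 0; 1]; rewrite !map_add0n; apply=> //=; lia.
(* By [inv] the color depends only on the number of unshifted blocks, so it is a coloring of
   numbers. *)
pose ct x := c (subst (nseq x 0 ++ nseq (D - x) 1) Es).
have [a [sa al sD [b hb]]] := folkman ct m0 cC.
case: a sa al sD hb => [|a0 a] /=; first by move=> sm; rewrite -sm in m0.
move=> sa /andP[a00 al] sD hb.
(* Each Folkman number becomes a run of that many zeros; the ones pad the first block so that all
   [D] positions are covered. *)
pose Fs := (nseq (D - (a0 + sumn a)) 1 ++ nseq a0 0) :: [seq nseq x 0 | x <- a].
have bF : blocks false m D Fs.
  split.
  - by rewrite /= size_map.
  - rewrite /= !size_cat !size_nseq size_flatten /shape -map_comp.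
    rewrite (eq_map (g := id)) ?map_id; last by move=> x /=; rewrite size_nseq.
    by rewrite -addnA subnK.
  apply/andP; split; first by rewrite /zeros mem_cat !mem_nseq a00 orbT.
  by apply/allP => E /mapP[x xa ->]; rewrite /zeros mem_nseq andbT; apply: (allP al).
have [f1 f2 f3] := bF.
exists (subst_comp Fs Es); split; first exact: blocks_comp bF (blocksW bE).
suff key e : size e = m -> 0 \in e -> c (subst e (subst_comp Fs Es)) = b.
  by move=> e e' se se' ze ze'; rewrite !map_add0n !key.
move=> se ze; have [e1 e2 e3] := bE.
rewrite -subst_subst ?f1 ?f2 //.
have sF : size (subst e Fs) = D by rewrite size_subst ?f1.
have cD : count_mem 0 (subst e Fs) <= D by rewrite -sF count_size.
rewrite (inv _ (nseq (count_mem 0 (subst e Fs)) 0 ++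
                nseq (D - count_mem 0 (subst e Fs)) 1)) //; first last.
- by rewrite count_cat !count_nseq /=; lia.
- by rewrite size_cat !size_nseq; lia.
apply: hb; last first.
  by rewrite -has_count has_pred1 (mem0_subst f3) // f1.
case: e se {ze sF cD} => [|y e]; first by move=> sm; rewrite -sm in m0.
rewrite -sa => -[se]; exists (map (eq_op^~ 0) (y :: e)); first by rewrite size_map /= se.
rewrite subst_cons count_cat count0_subst_nseq // count0_addn count_cat !count_nseq /=.
by rewrite mul1n; case: y => [|y]; rewrite /= ?mul1n ?mul0n.
Qed.

(** * From exponent vectors to FIN_k *)

(* An exponent vector [e] encodes the function with value [k - e_x] at [x];
   positions beyond the vector get the exponent [k], that is, the value 0. *)
Definition word_fun (k : nat) (e : seq nat) : nat -> nat := fun x => k - nth k e x.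

Definition block_of (Es : seq (seq nat)) (x : nat) : nat :=
  reshape_index (shape Es) x.

Lemma block_of_mono Es x y : x <= y -> block_of Es x <= block_of Es y.
Proof. by rewrite /block_of (reshape_leq (shape Es)); lia. Qed.

Lemma shape_subst e Es : size e = size Es ->
  shape [seq map (addn p.1) p.2 | p <- zip e Es] = shape Es.
Proof. by elim: e Es => [|a e IH] [|E Es] //= [se]; rewrite size_map IH. Qed.

Lemma nth_subst k e Es x : size e = size Es -> x < size (flatten Es) ->
  nth k (subst e Es) x = nth k e (block_of Es x) + nth k (flatten Es) x.
Proof.
move=> se; rewrite size_flatten => xn.
rewrite /subst !nth_flatten shape_subst // -/(block_of Es x).
have bm : block_of Es x < size Es by rewrite -(size_map size) reshape_indexP.
rewrite (nth_map (0, [::])) ?size_zip ?se ?minnn // nth_zip //= (nth_map k).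
  by congr (_ + _); apply: set_nth_default; rewrite se.
by rewrite -(nth_shape Es) reshape_offsetP.
Qed.

Lemma iter_tetris l h x : iter l tetris h x = h x - l.
Proof. by elim: l => [|l IH] /=; rewrite ?subn0 // /tetris IH; lia. Qed.

Lemma max_supp (h : nat -> nat) n y : h y != 0 -> (forall x, h x != 0 -> x < n) ->
  exists2 a, is_max (supp h) a & a < n.
Proof.
move=> hy hn.
have ex : exists x, h x != 0 by exists y.
have ub x : h x != 0 -> x <= n by move/hn/ltnW.
case: (ex_maxnP ex ub) => a ha am; exists a; last exact: hn.
by split.
Qed.

Lemma min_supp (h : nat -> nat) y : h y != 0 -> exists b, is_min (supp h) b.
Proof.
move=> hy; have ex : exists x, h x != 0 by exists y.
by case: (ex_minnP ex) => b hb bm; exists b; split.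
Qed.

Lemma FINn_word k n (h : nat -> nat) y : 0 < k -> (forall x, h x <= k) ->
  (forall x, h x != 0 -> x < n) -> h y = k -> FINn k n h.
Proof.
move=> k0 hk hn hy; split; last by apply: (@max_supp _ _ y); rewrite ?hy -?lt0n.
split=> //; first by exists y.
by apply: (sub_finite_set (B := `I_n%classic)) => [x /hn|]; last exact: finite_II.
Qed.

Section Transfer.
Variables (k m n : nat) (Es : seq (seq nat)).
Hypotheses (k0 : 0 < k) (bE : blocks false m n Es).

Let g x := k - nth k (flatten Es) x.
Let hs (i : 'I_m) : nat -> nat := fun x => if block_of Es x == i then g x else 0.

Lemma block_top (i : 'I_m) : exists2 x, x < n & block_of Es x = i /\ g x = k.
Proof.
have [sE sF aE] := bE.
have im : i < size Es by rewrite sE.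
have zE := allP aE _ (mem_nth [::] im); rewrite /zeros in zE.
pose c := index 0 (nth [::] Es i).
have cs : c < nth 0 (shape Es) i by rewrite nth_shape index_mem.
exists (flatten_index (shape Es) i c).
  by rewrite -sF size_flatten; apply: flatten_indexP.
rewrite /block_of flatten_indexKl //; split=> //.
rewrite /g nth_flatten flatten_indexKl // flatten_indexKr // /c.
by rewrite (@set_nth_default _ _ 0) ?index_mem // nth_index // subn0.
Qed.

Lemma g_support x : g x != 0 -> x < n.
Proof.
have [_ sF _] := bE; rewrite /g.
by case: ltnP => // nx; rewrite nth_default ?sF // subnn.
Qed.

Lemma FINn_blocks i : FINn k n (hs i).
Proof.
have [x _ [bx gx]] := block_top i.
apply: (@FINn_word _ _ _ x) => //; rewrite /hs; last by rewrite bx eqxx.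
  by move=> y; case: ifP => // _; rewrite /g leq_subr.
by move=> y; case: ifP => // _; apply: g_support.
Qed.

Lemma block_seq_blocks : block_seq hs.
Proof.
move=> i j ij.
have top l : exists x, hs l x != 0.
  by have [x _ [bx gx]] := block_top l; exists x; rewrite /hs bx eqxx gx -lt0n.
have [x hx] := top i; have [y hy] := top j.
have [|a Ma _] := max_supp (n := n) hx.
  by move=> z; rewrite /hs; case: ifP => // _; apply: g_support.
have [b Mb] := min_supp hy.
exists a, b; split=> //; case: Ma => ha _; case: Mb => hb _.
have blk l z : hs l z != 0 -> block_of Es z = l by rewrite /hs; case: ifP => [/eqP|].
by rewrite ltnNge; apply/negP => /(block_of_mono Es); rewrite (blk _ _ ha) (blk _ _ hb) leqNgt ij.
Qed.

(** The blocks have disjoint supports, so at each position at most one summand is nonzero. *)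
Lemma comb_space_blocks h : comb_space hs h ->
  exists e, [/\ size e = m, 0 \in e & h = word_fun k (subst e Es)].
Proof.
have [sE sF _] := bE.
move=> [p [i [l [p0 im [[j0 _ lj0] _] ->]]]].
have inj : injective i.
  move=> a b ab; case: (ltngtP a b) => [/im|/im|/val_inj //]; by rewrite ab ltnn.
(* A block omitted from the combination gets the exponent [k], hence the value 0. *)
pose e := [seq (if [pick j | i j == t] is Some j then l j else k) | t <- enum 'I_m].
have se : size e = m by rewrite size_map size_enum_ord.
have ne (t : 'I_m) : nth k e t = if [pick j | i j == t] is Some j then l j else k.
  by rewrite (nth_map t) ?size_enum_ord // nth_ord_enum.
have nei j : nth k e (i j) = l j.
  by rewrite ne; case: pickP => [j' /eqP/inj -> //|/(_ j)]; rewrite eqxx.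
exists e; split=> //.
  by rewrite -lj0 -(nei j0) mem_nth // se.
apply/funext => x; rewrite /word_fun.
have [xn|nx] := ltnP x n; last first.
  rewrite nth_default ?size_subst ?se ?sF // subnn big1 // => j _.
  rewrite iter_tetris /hs; case: ifP => _ //.
  by rewrite /g nth_default ?sF // subnn.
rewrite nth_subst ?se ?sF //.
have bm : block_of Es x < m by rewrite -sE -(size_map size) reshape_indexP // -size_flatten sF.
set t := Ordinal bm.
have -> : block_of Es x = t by [].
rewrite ne; case: pickP => [j /eqP ij|no].
  rewrite (bigD1 j) //= big1 ?addn0.
    by rewrite iter_tetris /hs ij eqxx /g addnC subnDA.
  move=> j' nj; rewrite iter_tetris /hs; case: eqP => // bx.
  by case/eqP: nj; apply: inj; apply: val_inj; rewrite /= -bx ij.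
rewrite big1 ?subnDA ?subnn // => j _; rewrite iter_tetris /hs; case: eqP => // bx.
by have /eqP := no j; case; apply: val_inj; rewrite /= bx.
Qed.

End Transfer.

Lemma FIN_ramsey_of_gowers k m r n : 0 < k -> 0 < m -> gowers k m r.+1 n ->
  FIN_ramsey k m r.+1 n.
Proof.
move=> k0 m0 R c.
(* The default [ord0] goes only to words that do not encode an element of FIN_k(n). *)
pose cw (e : seq nat) : 'I_r.+1 := oapp c ord0 (insub (word_fun k e)).
have cc : capped k n cw.
  move=> e se; rewrite /cw; congr (oapp c ord0 (insub _)).
  apply/funext => x; rewrite /word_fun.
  have [xn|nx] := ltnP x (size e); first by rewrite (nth_map k) //; lia.
  by rewrite !nth_default ?size_map.
have [|Es [bE hE]] := R _ cw _ cc; first by rewrite card_ord.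
exists (fun (i : 'I_m) x => if block_of Es x == i then k - nth k (flatten Es) x else 0).
split; first exact: FINn_blocks bE.
  exact: block_seq_blocks bE.
exists (cw (subst (nseq m 0) Es)) => h /(comb_space_blocks bE)[e [se e0 he]].
have -> : c h = cw (subst e Es) by rewrite /cw -he valK.
have := hE e (nseq m 0) se (size_nseq _ _) e0; rewrite !map_add0n; apply.
by rewrite /zeros mem_nseq m0 eqxx.
Qed.

(** * The Ackermann hierarchy *)

Lemma ack2E x : ack 2 x = 2 ^ x.
Proof. by elim: x => // x IH; rewrite expnS -IH. Qed.

Lemma ackSS j x : ack j.+2 x.+1 = ack j.+1 (ack j.+2 x).
Proof. by []. Qed.

Lemma ack_gt_pos j x : 0 < x -> x < ack j.+1 x.
Proof.
elim: j x => [|j IH] x x0; first by rewrite /= mul2n -addnn -{1}(addn0 x) ltn_add2l.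
elim: x {x0} => // x IHx; rewrite ackSS.
have [->|x0] := posnP x; first exact: IH.
by apply: leq_ltn_trans (IHx) (IH _ _); apply: leq_trans (IHx).
Qed.

Lemma ack_gt j x : x < ack j.+2 x.
Proof. by case: x => // x; apply: ack_gt_pos. Qed.

Lemma ack_ge j x : x <= ack j.+1 x.
Proof. by case: x => // x; apply/ltnW/ack_gt_pos. Qed.

Lemma ack_ltS j x : ack j.+1 x < ack j.+1 x.+1.
Proof.
case: j => [|j]; first by rewrite /= !mul2n ltn_double.
by rewrite ackSS; apply/ack_gt_pos/(leq_trans _ (ack_gt j x)).
Qed.

Lemma ack_mono j : {homo ack j.+1 : x y / x <= y}.
Proof. by apply: homo_leq => [//|y x z|x]; [apply: leq_trans | apply/ltnW/ack_ltS]. Qed.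

Lemma ack_addr j x a : ack j.+1 x + a <= ack j.+1 (x + a).
Proof.
elim: a => [|a IH]; rewrite ?addn0 // !addnS.
exact: leq_trans (ack_ltS _ _).
Qed.

Lemma ack_index i j x : i <= j -> ack i.+1 x <= ack j.+1 x.
Proof.
elim: j => [|j IH]; first by case: i.
rewrite leq_eqVlt => /predU1P[-> //|/IH le_ij]; apply: leq_trans le_ij _.
case: x {IH} => [|x]; first by case: (j).
by rewrite ackSS; apply/ack_mono/ack_gt.
Qed.

(** Both sides iterate [ack j.+1] from 1. This turns a number of iterations into an argument one
    level higher. *)
Lemma ack_iter j t x : iter t (ack j.+1) (ack j.+2 x) = ack j.+2 (t + x).
Proof. by rewrite [RHS]/= iterD. Qed.

Lemma iter_mono j t : {homo iter t (ack j.+1) : x y / x <= y}.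
Proof. by elim: t => [|t IH] x y xy //=; apply/ack_mono/IH. Qed.

Lemma iter_ge j t x : x <= iter t (ack j.+1) x.
Proof. by elim: t => //= t IH; apply: leq_trans IH (ack_ge _ _). Qed.

Lemma iter_addr j t x a : iter t (ack j.+1) x + a <= iter t (ack j.+1) (x + a).
Proof.
elim: t => //= t IH; apply: leq_trans (ack_addr _ _ _) _; exact: ack_mono.
Qed.

Lemma iter_le_ack j t x : iter t (ack j.+1) x <= ack j.+2 (t + x).
Proof. by rewrite -ack_iter; apply/iter_mono/ack_ge. Qed.

Lemma exp2_le_ack j x : 2 ^ x <= ack j.+2 x.
Proof. by rewrite -ack2E; apply: ack_index. Qed.

Lemma double_exp x : 0 < x -> x + x <= 2 ^ x.
Proof.
case: x => // x _; elim: x => // x IH; rewrite expnS mul2n -addnn.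
have := ltn_expl x.+1 (isT : 1 < 2); lia.
Qed.

(** The factor 50 covers the linear terms of the estimates below, and 9 is the first argument from
    which the inequality persists. *)
Lemma lin_exp x : 9 <= x -> 50 * x <= 2 ^ x.
Proof.
move=> /subnK <-; elim: (x - 9) => // y IH; rewrite addSn expnS; lia.
Qed.

Lemma quad_exp x : 9 <= x -> x.+1 * x + 4 <= 2 ^ x.
Proof.
move=> /subnK <-; elim: (x - 9) => // y IH; rewrite addSn expnS.
have := lin_exp (leq_addl y 9); move: (y + 9) IH => z; nia.
Qed.

Lemma ack_ge_add j x : 3 <= x -> x + j.+2 <= ack j.+2 x.
Proof.
have e x' : 2 <= x' -> x' + 2 <= 2 ^ x'.
  by move=> /subnK <-; elim: (x' - 2) => // y IH; rewrite addSn expnS; lia.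
elim: j x => [|j IH] x x3; first by rewrite ack2E e // ltnW.
case: x x3 => // x x2; rewrite ackSS.
have h : x.+2 <= ack j.+3 x.
  by apply: leq_trans (exp2_le_ack j.+1 x); rewrite -addn2; apply: e.
apply: leq_trans (ack_mono j.+1 h); apply: leq_trans (IH _ _) => //; lia.
Qed.

(** * Bounds *)

(** One step of the recursion of [hilbert_bound] costs three exponentials, two for the power and one
    for the sum. *)
Lemma expnS_bound r : r ^ r.+1 + r.+1 <= iter 3 (ack 2) r.+1.
Proof.
have h : r * r.+1 <= 2 ^ r.+1.
  elim: r => // r IH; have := ltn_expl r (isT : 1 < 2); rewrite !expnS in IH *; nia.
have h1 : r ^ r.+1 <= 2 ^ (2 ^ r.+1).
  apply: leq_trans (_ : 2 ^ (r * r.+1) <= _); last by rewrite leq_exp2l.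
  by rewrite expnM leq_exp2r //; apply/ltnW/ltn_expl.
have h2 : r.+1 <= 2 ^ (2 ^ r.+1).
  by apply/ltnW/(ltn_trans (ltn_expl r.+1 (isT : 1 < 2)))/ltn_expl.
rewrite [iter _ _ _]/= -/(ack 2 r.+1) -/(ack 2 (ack 2 r.+1)) -/(ack 2 (ack 2 (ack 2 r.+1))) !ack2E.
apply: leq_trans (leq_add h1 h2) _; apply: double_exp; exact: leq_trans h2.
Qed.

Lemma hilbert_bound_iter s r : hilbert_bound s r <= iter (3 * s) (ack 2) r.+1.
Proof.
elim: s r => [|s IH] r //; rewrite [hilbert_bound _ _]/=.
apply: leq_trans (_ : iter (3 * s) (ack 2) (r ^ r.+1 + r.+1) <= _).
  apply: leq_trans (leq_add (IH _) (leqnn r)) _.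
  apply: leq_trans (iter_addr _ _ _ _) _; apply: iter_mono; lia.
by rewrite mulnS [3 + _]addnC iterD; apply/iter_mono/expnS_bound.
Qed.

(** With [S] the previous bound, [3 * S] exponentials on [r.+1] stay below [ack 3 (3 * S + r + 1)].
    One more unit in the argument gives an exponential that absorbs the factor 3 and the added
    terms. *)
Lemma stable_bound_ack t r : 2 <= r -> 3 * stable_bound t r + r + 2 <= ack 4 (t + r).
Proof.
move=> r2; elim: t => [|t IH].
  (* For [r = 2] both sides equal 4. *)
  rewrite muln0 !add0n; elim: r r2 => [//|r IH']; rewrite leq_eqVlt => /predU1P[<- //|r2].
  by apply: leq_trans (ack_ltS 3 r); rewrite addSn ltnS IH'.
rewrite addSn ackSS; set S := stable_bound t r in IH *.
have hY : stable_bound t.+1 r <= ack 3 (3 * S + r + 1).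
  have -> : stable_bound t.+1 r = hilbert_bound S r by [].
  apply: leq_trans (hilbert_bound_iter _ _) _.
  by apply: leq_trans (iter_le_ack _ _ _) _; apply: ack_mono; lia.
apply: leq_trans (ack_mono 2 IH).
have -> : 3 * S + r + 2 = (3 * S + r + 1).+1 by lia.
rewrite ackSS ack2E.
have Yr := ack_gt 1 (3 * S + r + 1).
have Y9 : 9 <= ack 3 (3 * S + r + 1).
  apply: leq_trans (_ : ack 3 3 <= _); first by [].
  by apply: ack_mono; lia.
have := lin_exp Y9; move: (ack 3 _) hY Yr {Y9} => Y; lia.
Qed.

(** The factor [P = (2 * r) ^ (2 ^ q)] makes the recursion telescope: [P * P] is the factor for
    [q.+1], and one [P] exceeds [r ^ (2 ^ q)], with room for the successor. *)
Lemma inner_bound_single r s q : 0 < r ->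
  (inner_bound 1 r muln s q).+1 * (2 * r) ^ (2 ^ q) <= (2 * r) ^ (2 ^ (q + s)).
Proof.
move=> r0; elim: s q => [|s IH] q; first by rewrite /= mul1n addn0.
rewrite addnS -addSn; apply: leq_trans (IH q.+1).
rewrite [inner_bound _ _ _ s.+1 _]/=; set x := inner_bound _ _ _ s _.
have -> : 2 ^ q.+1 = 2 ^ q + 2 ^ q by rewrite expnS mul2n addnn.
rewrite expnD; set P := (2 * r) ^ (2 ^ q).
have P0 : 0 < P by rewrite expn_gt0 muln_gt0 r0.
have hP : r ^ 2 ^ q + 1 <= P.
  rewrite /P expnMn; have : 0 < r ^ 2 ^ q by rewrite expn_gt0 r0.
  have : 2 <= 2 ^ 2 ^ q by rewrite -{1}(expn1 2) leq_exp2l // expn_gt0.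
  move: (2 ^ 2 ^ q) (r ^ 2 ^ q) => a b; nia.
rewrite mulnA leq_mul2r; apply/orP; right.
move: (r ^ 2 ^ q) hP => b; nia.
Qed.

(** The added term dominates all parameters. Per step, two exponentials bound [inner_bound] and a
    third restores the added term. *)
Lemma outer_bound_single D r t b : 0 < r -> t + b <= D ->
  outer_bound 1 r muln t b + (D + 1 + 2 * r) <= iter (3 * t) (ack 2) (D + 1 + 2 * r).
Proof.
move=> r0; set v := D + 1 + 2 * r.
elim: t b => [//|t IH] b tb.
rewrite mulnS iterD; apply: leq_trans (iter_mono _ 3 (IH b.+1 _)); last by rewrite addnS.
rewrite [outer_bound _ _ _ _ _]/=; set x := outer_bound _ _ _ t _.
rewrite [iter _ _ _]/= -/(ack 2 (x + v)) -/(ack 2 (ack 2 _)) -/(ack 2 (ack 2 (ack 2 _))) !ack2E.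
have h : inner_bound 1 r muln x.+1 b <= 2 ^ 2 ^ (x + v).
  apply: leq_trans (_ : (2 * r) ^ (2 ^ (b + x.+1)) <= _).
    apply: leq_trans (inner_bound_single _ _ r0).
    apply: leq_trans (leqnSn _) _; rewrite leq_pmulr // expn_gt0 muln_gt0 r0 //.
  apply: leq_trans (_ : (2 ^ (2 * r)) ^ (2 ^ (b + x.+1)) <= _).
    by rewrite leq_exp2r ?expn_gt0 //; apply/ltnW/ltn_expl.
  rewrite -expnM leq_exp2l //.
  apply: leq_trans (_ : 2 ^ (2 * r) * 2 ^ (b + x.+1) <= _).
    by rewrite leq_mul2r; apply/orP; right; apply/ltnW/ltn_expl.
  by rewrite -expnD leq_exp2l // /v; lia.
have h2 : v <= 2 ^ 2 ^ (x + v).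
  apply: leq_trans (leq_addl x v) _.
  by apply/ltnW/(ltn_trans (ltn_expl (x + v) (isT : 1 < 2)))/ltn_expl.
apply: leq_trans (leq_add h h2) _; apply: double_exp; by rewrite expn_gt0.
Qed.

Lemma gowers1_bound_ack m r : 0 < m -> 2 <= r -> gowers1_bound m r <= ack 4 (m * r + 3).
Proof.
move=> m0 r2; rewrite /gowers1_bound; set D := folkman_bound m r.
have hD := stable_bound_ack (r * m.-1).+1 r2; rewrite -/(folkman_bound m r) -/D in hD.
have e : (r * m.-1).+1 + r = m * r + 1 by case: (m) m0 => //= m' _; lia.
rewrite {}e in hD.
have r0 : 0 < r by apply: ltnW.
have := @outer_bound_single D r D 0 r0; rewrite addn0 leqnn => /(_ isT) h.
apply: leq_trans (leq_trans (leq_addr _ _) h) _.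
apply: leq_trans (iter_le_ack _ _ _) _.
(* One of the two extra units comes from the [3 * D] exponentials, the other from doubling [y]. *)
have -> : m * r + 3 = (m * r + 1).+2 by lia.
rewrite (ackSS 2 (m * r + 1).+1) (ackSS 2 (m * r + 1)); apply: ack_mono.
move: (ack 4 _) hD => y hD.
apply: leq_trans (exp2_le_ack 1 y); apply: leq_trans (double_exp _); lia.
Qed.

(** * Growth in the step from FIN_k to FIN_(k+1) *)

Section StepBound.
Variables (i k r : nat) (G : nat -> nat -> nat).
Hypotheses (ki : k <= i) (i2 : 2 <= i) (r2 : 2 <= r).
Hypothesis GB : forall m s, 0 < m -> 2 <= s -> G m s <= ack i.+2 (ack 4 (m * s + 4)).

(** [Q] bounds the number of colors in all rounds. A round costs three applications: for the outer
    function of [GB], for [ack 4], and for the product [m * s + 4]. *)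
Lemma inner_bound_ack s q Q : 9 <= Q -> r ^ k.+1 ^ (q + s) <= Q ->
  inner_bound k r G s q <= iter (3 * s) (ack i.+2) Q.
Proof.
move=> Q9; elim: s q => [|s IH] q hQ //.
rewrite [inner_bound _ _ _ _ _]/= mulnS iterD.
have hx : inner_bound k r G s q.+1 <= iter (3 * s) (ack i.+2) Q.
  by apply: IH; rewrite addSn -addnS.
move: (inner_bound _ _ _ _ _) (iter (3 * s) _ _) (iter_ge i.+1 (3 * s) Q) hx => x Y QY xY.
have r0 : 0 < r by apply: ltnW.
have R2 : 2 <= r ^ k.+1 ^ q.
  by apply: leq_trans r2 _; rewrite -{1}(expn1 r) leq_pexp2l // expn_gt0.
have RQ : r ^ k.+1 ^ q <= Y.
  by apply: leq_trans QY; apply: leq_trans hQ; rewrite leq_pexp2l // leq_pexp2l // leq_addr.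
apply: leq_trans (GB (ltn0Sn x) R2) _; rewrite [iter 3 _ _]/= -/(ack i.+2).
apply: ack_mono; apply: leq_trans (ack_index _ (_ : 3 <= i.+1)) _ => //.
apply: ack_mono; apply: leq_trans (exp2_le_ack _ _).
apply: leq_trans (quad_exp (leq_trans Q9 QY)); rewrite leq_add2r; exact: leq_mul.
Qed.

Lemma tower_bound V b : 9 <= V -> r <= V -> k.+1 <= V -> b <= V ->
  r ^ k.+1 ^ b <= 2 ^ 2 ^ 2 ^ 2 ^ V.
Proof.
move=> V9 rV kV bV; have V0 : 0 < V by apply: leq_trans V9.
have e x : x <= 2 ^ x by apply/ltnW/ltn_expl.
have h1 : k.+1 ^ b <= 2 ^ 2 ^ V.
  apply: leq_trans (_ : V ^ V <= _).
    apply: leq_trans (_ : V ^ b <= _); last by rewrite leq_pexp2l.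
    by case: (b) => // b'; rewrite leq_exp2r.
  apply: leq_trans (_ : 2 ^ (V * V) <= _).
    by rewrite expnM leq_exp2r.
  by rewrite leq_exp2l //; apply: leq_trans (quad_exp V9); nia.
apply: leq_trans (_ : 2 ^ (V * 2 ^ 2 ^ V) <= _).
  rewrite expnM; apply: leq_trans (_ : (2 ^ V) ^ (k.+1 ^ b) <= _).
    by rewrite leq_exp2r ?expn_gt0 //; apply: leq_trans (e V).
  by rewrite leq_pexp2l // expn_gt0.
rewrite leq_exp2l //; apply: leq_trans (_ : 2 ^ V * 2 ^ 2 ^ V <= _).
  by rewrite leq_mul2r e orbT.
rewrite -expnD leq_exp2l //; apply: leq_trans (double_exp _); last by rewrite expn_gt0.
by rewrite leq_add2r.
Qed.

(** Of the seven applications, four cover the tower of colors, one the sum [3 * x.+1 + Q], one the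
    iterations in [inner_bound], and one restores the added term. *)
Lemma outer_bound_iter M t b : t + b <= M ->
  outer_bound k r G t b + (M + k + r + 12) <= iter (7 * t) (ack i.+3) (M + k + r + 12).
Proof.
set v := M + k + r + 12; elim: t b => [//|t IH] b tb.
rewrite mulnS iterD; apply: leq_trans (iter_mono _ 7 (IH b.+1 _)); last by rewrite addnS.
have -> : outer_bound k r G t.+1 b = inner_bound k r G (outer_bound k r G t b.+1).+1 b by [].
set x := outer_bound _ _ _ t _; set V := x + v.
set F := ack i.+3.
pose Q := 9 + r ^ k.+1 ^ (b + x.+1).
have V9 : 9 <= V by rewrite /V /v; lia.
have hQ : Q <= 9 + 2 ^ 2 ^ 2 ^ 2 ^ V.
  by rewrite leq_add2l tower_bound // /V /v; lia.
have hin : inner_bound k r G x.+1 b <= F (3 * x.+1 + Q).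
  apply: leq_trans (@inner_bound_ack x.+1 b Q _ _) _; try exact: leq_addl; try exact: leq_addr.
  exact: iter_le_ack.
have e y : y <= 2 ^ y by apply/ltnW/ltn_expl.
have h5 : 3 * x.+1 + Q <= 2 ^ 2 ^ 2 ^ 2 ^ 2 ^ V.
  have VZ : V <= 2 ^ 2 ^ 2 ^ 2 ^ V by do 3!apply: leq_trans (e _) _ => //; rewrite ?leq_exp2l.
  have := lin_exp (leq_trans V9 VZ).
  move: (2 ^ 2 ^ 2 ^ 2 ^ V) hQ VZ => Z; rewrite /V /v; lia.
have hF y : 2 ^ y <= F y by apply: exp2_le_ack.
have hFm y z : y <= z -> F y <= F z by apply: ack_mono.
have hF5 : 2 ^ 2 ^ 2 ^ 2 ^ 2 ^ V <= iter 5 F V.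
  do 4!(apply: leq_trans (hF _) (hFm _ _ _)); exact: hF.
have h6 : inner_bound k r G x.+1 b <= iter 6 F V.
  by apply: leq_trans hin _; rewrite [iter 6 _ _]iterS; apply/hFm/(leq_trans h5).
have hV : v <= iter 6 F V by apply: leq_trans (iter_ge _ _ _); apply: leq_addl.
rewrite [iter 7 _ _]iterS; apply: leq_trans (leq_add h6 hV) _.
apply: leq_trans (hF _); apply: double_exp; apply: leq_trans hV; rewrite /v; lia.
Qed.

Lemma outer_bound_ack M : outer_bound k r G M 0 <= ack i.+4 (8 * M + r + 12).
Proof.
have := @outer_bound_iter M M 0; rewrite addn0 leqnn => /(_ isT) h.
apply: leq_trans (leq_trans (leq_addr _ _) h) _.
(* [ack_ge_add] absorbs [k], since [k <= i]; the [7 * M] iterations then move into the argument. *)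
apply: leq_trans (_ : iter (7 * M) (ack i.+3) (ack i.+4 (M + r + 12)) <= _).
  apply: iter_mono; apply: leq_trans (ack_ge_add _ _); lia.
by rewrite ack_iter; apply: ack_mono; lia.
Qed.

End StepBound.

(** The index is shifted: [gowers_bound k] belongs to FIN_(k+1). *)
Fixpoint gowers_bound (k : nat) : nat -> nat -> nat :=
  if k is k'.+1
  then fun m r => outer_bound k.+1 r (gowers_bound k') (3 * gowers1_bound m r) 0
  else gowers1_bound.

Lemma gowers_succ_bound k m r : 0 < m -> gowers k.+1 m r (gowers_bound k m r).
Proof.
elim: k m r => [|k IH] m r m0; first exact: gowers1.
exact: (@gowers_succ k.+1 m r (gowers_bound k) _ IH (@gowers1 m r m0)).
Qed.

(** Each step climbs two levels, one for iterating [G] and one for iterating [inner_bound]. The last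
    unit of [m * r + 4] absorbs the factor [8 * 3] before [gowers1_bound]. *)
Lemma gowers_bound_ack k m r : 0 < m -> 2 <= r ->
  gowers_bound k m r <= ack (2 * k).+4 (ack 4 (m * r + 4)).
Proof.
elim: k m r => [|k IH] m r m0 r2.
  apply: leq_trans (gowers1_bound_ack m0 r2) (leq_trans _ (ack_ge _ _)).
  by apply: ack_mono; rewrite leq_add2l.
have h := @outer_bound_ack (2 * k).+2 k.+2 r (gowers_bound k) _ isT r2 IH.
have -> : 2 * k.+1 = (2 * k).+2 by lia.
apply: leq_trans (h _ _) _; first by lia.
apply: ack_mono; have -> : m * r + 4 = (m * r + 3).+1 by lia.
rewrite ackSS.
have := gowers1_bound_ack m0 r2.
have := @ack_ge_add 2 (m * r + 3) (leq_addl _ _).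
have : r <= m * r by rewrite leq_pmull.
move: (gowers1_bound _ _) (ack 4 _) => x y rm hy xy.
apply: leq_trans (exp2_le_ack 1 y); apply: leq_trans (lin_exp _); lia.
Qed.

(** * The theorem *)

Lemma gowers_one_block k r : gowers k 1 r 1.
Proof.
move=> C c _ _; exists [:: [:: 0]]; split; first exact: (blocks_id false 1).
by case=> [|[|x] [|y e]] // [|[|x'] [|y' e']].
Qed.

Lemma FIN_ramsey_bounded k m : 2 <= k -> 1 <= m ->
  exists2 n, FIN_ramsey k m 2 n & n <= ack (4 + 2 * (k - 1)) (ack 4 (6 * m - 2)).
Proof.
case: k => // k k1 m0.
have -> : 4 + 2 * (k.+1 - 1) = (2 * k).+4 by lia.
(* The general bound has the argument [2 * m + 4], which is at most [6 * m - 2] only from [m = 2]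
   on. *)
have [m1|m2] := leqP m 1.
  have -> : m = 1 by lia.
  exists 1; first exact/FIN_ramsey_of_gowers/gowers_one_block.
  exact: leq_ltn_trans (leq0n _) (ack_gt _ _).
exists (gowers_bound k m 2).
  exact/FIN_ramsey_of_gowers/gowers_succ_bound.
apply: leq_trans (gowers_bound_ack _ m0 _) _ => //.
by do 2!apply: ack_mono; lia.
Qed.

Theorem mainTheorem2 (k m : nat) (hk : 2 <= k) (hm : 1 <= m) :
  exists2 g : nat, is_g k m 2 g & g <= ack (4 + 2 * (k - 1)) (ack 4 (6 * m - 2)).
Proof.
have [n Rn ln] := FIN_ramsey_bounded hk hm.
have ex : exists n, `[< FIN_ramsey k m 2 n >] by exists n; apply/asboolP.
case: (ex_minnP ex) => g /asboolP Rg gmin; exists g.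
  by split=> // n' Rn'; apply/gmin/asboolP.
by apply: leq_trans ln; apply/gmin/asboolP.
Qed.
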